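(* There is an absolute constant $C$ such that for all integers $n\ge 2$ and $1\le k\le \log n$ and every bipartite matching input $(S_1,\dots,S_n)$ with $n$ players and $n$ items, the expected size of the matching produced by the $k$-round random greedy algorithm (defined in the context) is at least $\frac{OPT}{C\, n^{1/(k+1)}}$, i.e. its approximation ratio is $O(n^{1/(k+1)})$. In particular, for $k=1$ the approximation ratio is $O(\sqrt n)$, and for $k=\Theta(\log n)$ the approximation ratio is $O(1)$.
   Context: Bipartite matching problem: there are $n$ players $V_1$ and $n$ items $V_2$; player $i$ privately knows a set $S_i\subseteq V_2$ of items that he demands. A matching gives each player at most one item of $S_i$, no item to two players; $OPT$ is the maximum number of players that can be matched. $\log$ is base 2. The $k$-round random greedy algorithm: let $N_1=V_1$ and $U_1=V_2$. In every round $r=1,\dots,k$: (a) each player $i\in N_r$ selects uniformly at random (independently of the others) an item $j_i\in U_r\cap S_i$ and reports its index (he reports nothing if $U_r\cap S_i=\emptyset$); (b) go over the players of $N_r$ in a fixed arbitrary order, and player $i$ receives $j_i$ if this item was not allocated yet; (c) $N_{r+1}\subseteq N_r$ is the set of players not allocated an item in round $r$ or before; (d) $U_{r+1}\subseteq U_r$ is the set of items not allocated in round $r$ or before. Each player sends $O(\log n)$ bits in each round. *)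

(* Defs.v *)
From HB Require Import structures.
From mathcomp Require Import all_boot all_order all_algebra.
From mathcomp Require Import reals exp.

Set Implicit Arguments.
Unset Strict Implicit.
Unset Printing Implicit Defensive.

Import Order.TTheory GRing.Theory Num.Theory.

Local Open Scope ring_scope.

Definition log2 (R : realType) (x : R) : R := ln x / ln 2.

(* Players and items are both indexed by 'I_n.  An [assignment] maps each
   player to at most one item.  The same type is used for the vector of
   reports of one round ([None] = reports nothing). *)
Definition assignment (n : nat) : finType := {ffun 'I_n -> option 'I_n}.

Definition no_assignment (n : nat) : assignment n := [ffun=> None].

Definition assigned n (m : assignment n) : {set 'I_n} :=
  [set i | m i != None].

Definition is_matching n (dem : 'I_n -> {set 'I_n}) (m : assignment n) : bool :=
  [forall i, forall j, (m i == Some j) ==> (j \in dem i)] &&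
  [forall i, forall i', forall j,
     (m i == Some j) && (m i' == Some j) ==> (i == i')].

Definition OPT n (dem : 'I_n -> {set 'I_n}) : nat :=
  \max_(m : assignment n | is_matching dem m) #|assigned m|.

(* The sets N_r and U_r, as functions of the allocation made before round r. *)
Definition unassigned_players n (m : assignment n) : {set 'I_n} :=
  [set i | m i == None].

Definition free_items n (m : assignment n) : {set 'I_n} :=
  [set j | [forall i, m i != Some j]].

(* Probability that player i reports o, given the current allocation m. *)
Definition report_prob (R : realType) n (dem : 'I_n -> {set 'I_n})
    (m : assignment n) (i : 'I_n) (o : option 'I_n) : R :=
  let A := free_items m :&: dem i in
  if (i \in unassigned_players m) && (A != set0) then
    if o is Some j then (j \in A)%:R / #|A|%:R else 0
  else (o == None)%:R.

(* The reports of one round are independent given m. *)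
Definition reports_prob (R : realType) n (dem : 'I_n -> {set 'I_n})
    (m q : assignment n) : R :=
  \prod_(i < n) report_prob R dem m i (q i).

Definition give n (q m : assignment n) (i : 'I_n) : assignment n :=
  if q i is Some j then
    if j \in free_items m then [ffun i' => if i' == i then Some j else m i']
    else m
  else m.

(* One round with reports q, where ord lists the players in the fixed order;
   availability of an item is tested against the allocation updated so far. *)
Definition allocate n (ord : seq 'I_n) (m q : assignment n) : assignment n :=
  foldl (give q) m [seq i <- ord | i \in unassigned_players m].

(* Law of the allocation after r rounds. *)
Fixpoint greedy_law (R : realType) n (dem : 'I_n -> {set 'I_n})
    (ord : seq 'I_n) (r : nat) (m : assignment n) : R :=
  if r is r'.+1 then
    \sum_(m' : assignment n) greedy_law R dem ord r' m' *
      \sum_(q : assignment n | allocate ord m' q == m) reports_prob R dem m' q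
  else (m == no_assignment n)%:R.

Definition greedy_expected_size (R : realType) n (dem : 'I_n -> {set 'I_n})
    (ord : seq 'I_n) (k : nat) : R :=
  \sum_(m : assignment n) greedy_law R dem ord k m * #|assigned m|%:R.

(* Main.v *)
(* Put a = n^(1/(k+1)) and let s_r(i) be the number of free items that player i
   demands after r rounds.  Given the reports of the others, an unallocated
   player i succeeds in a round with probability at least s_{r+1}(i) / s_r(i),
   since the items still free after the round were free at his turn.  Hence the
   expected number of players whose set stays larger than a^(k-r-1) although
   it had size at most a^(k-r) is at most a times the expected number of players
   served in that round.  Players with |S_i| > a^k are handled by the first
   round: their sets shrink by at most the size of the matching.  Before round
   k all other players left have s(i) <= a; of these, one whose optimal item is
   still free reports it with probability at least 1/a, and then this item gets
   allocated.  Summing over the players of an optimal matching yields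
   OPT <= (3 + 2 a) E[ALG] <= 5 a E[ALG]. *)
Require Import Defs.
From HB Require Import structures.
From mathcomp Require Import all_boot all_order all_algebra.
From mathcomp Require Import reals exp.
From mathcomp Require Import lra.

Set Implicit Arguments.
Unset Strict Implicit.
Unset Printing Implicit Defensive.

Import Order.TTheory GRing.Theory Num.Theory.

Local Open Scope ring_scope.

(** * Expectation with respect to a finite weight function *)

Section Mean.
Variables (R : realType) (T : finType) (p : T -> R).

Definition mean (f : T -> R) : R := \sum_x p x * f x.

Lemma eq_mean f g : f =1 g -> mean f = mean g.
Proof. by move=> fg; apply: eq_bigr => x _; rewrite fg. Qed.

Lemma meanD f g : mean (fun x => f x + g x) = mean f + mean g.
Proof. by rewrite /mean -big_split; apply: eq_bigr => x _; rewrite mulrDr. Qed.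

Lemma meanZ c f : mean (fun x => c * f x) = c * mean f.
Proof. by rewrite /mean mulr_sumr; apply: eq_bigr => x _; rewrite mulrCA. Qed.

Lemma meanB f g : mean (fun x => f x - g x) = mean f - mean g.
Proof.
rewrite -[- mean g]mulN1r -meanZ -meanD.
by apply: eq_mean => x; rewrite mulN1r.
Qed.

Lemma mean_sum (I : finType) (P : pred I) (f : I -> T -> R) :
  mean (fun x => \sum_(i | P i) f i x) = \sum_(i | P i) mean (f i).
Proof.
by rewrite /mean exchange_big; apply: eq_bigr => x _; rewrite mulr_sumr.
Qed.

Hypothesis p_ge0 : forall x, 0 <= p x.

Lemma ler_mean f g : (forall x, f x <= g x) -> mean f <= mean g.
Proof. by move=> fg; apply: ler_sum => x _; rewrite ler_wpM2l. Qed.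

Lemma mean_ge0 f : (forall x, 0 <= f x) -> 0 <= mean f.
Proof. by move=> f0; apply: sumr_ge0 => x _; rewrite mulr_ge0. Qed.

Hypothesis p_sum1 : \sum_x p x = 1.

Lemma mean_cst c : mean (fun=> c) = c.
Proof. by rewrite /mean -mulr_suml p_sum1 mul1r. Qed.

End Mean.

(** * One round with fixed reports *)

Section Allocation.
Variables (n : nat) (ord : seq 'I_n).
Hypothesis ord_uniq : uniq ord.

Definition extends (m m' : assignment n) :=
  forall i j, m i = Some j -> m' i = Some j.

Lemma extends_free_items m m' : extends m m' ->
  free_items m' \subset free_items m.
Proof.
move=> mm'; apply/subsetP => j; rewrite !inE => /forallP m'j.
apply/forallP => i; apply: contra (m'j i) => /eqP mi.
by apply/eqP; apply: mm'.
Qed.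

Lemma extends_unassigned m m' i : extends m m' -> m' i = None -> m i = None.
Proof. by move=> mm' m'i; case E: (m i) => [j|] //; move: m'i; rewrite (mm' _ _ E). Qed.

Lemma extends_assigned m m' : extends m m' -> assigned m \subset assigned m'.
Proof.
move=> mm'; apply/subsetP => i; rewrite !inE; apply: contra => /eqP m'i.
by apply/eqP; apply: extends_unassigned m'i.
Qed.

Lemma foldl_give_notin (q : assignment n) s (m : assignment n) i : i \notin s -> foldl (give q) m s i = m i.
Proof.
elim: s m => //= x s IH m; rewrite inE negb_or => /andP[ix /IH ->].
rewrite /give; case: (q x) => // j; case: ifP => // _.
by rewrite ffunE (negPf ix).
Qed.

Lemma foldl_give_extends (q : assignment n) s (m : assignment n) :
  (forall i, i \in s -> m i = None) -> extends m (foldl (give q) m s).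
Proof.
move=> ms i j mij; rewrite foldl_give_notin //.
by apply/negP => /ms; rewrite mij.
Qed.

Lemma allocate_extends m q : extends m (allocate ord m q).
Proof.
apply: foldl_give_extends => i; rewrite mem_filter inE.
by case/andP => /eqP.
Qed.

Definition turn_order (m : assignment n) :=
  [seq i <- ord | i \in unassigned_players m].

Definition at_turn (m q : assignment n) i :=
  foldl (give q) m (take (index i (turn_order m)) (turn_order m)).

Definition replace (q : assignment n) i o : assignment n :=
  [ffun i' => if i' == i then o else q i'].

(** Players served before [i] never consult his report. Hence his report can be resampled while the
    state he meets stays fixed. *)
Lemma at_turn_replace m q i o : at_turn m (replace q i o) i = at_turn m q i.
Proof.
rewrite /at_turn.
have: i \notin take (index i (turn_order m)) (turn_order m).
  by rewrite in_take_leq ?index_size // ltnn.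
move: (take (index i _) _) => s; elim: s m => //= x s IH m; rewrite inE negb_or => /andP[ix i_s].
rewrite IH //; congr (foldl _ _ _).
by rewrite /give ffunE eq_sym (negPf ix).
Qed.

Section Turn.
Variables (m q : assignment n) (i : 'I_n).
Hypotheses (i_ord : i \in ord) (mi : m i = None).

(** The turn order splits around [i]. By uniqueness the later players differ from [i], and they are
    still unassigned when he has been served, so nothing given so far is overwritten. *)
Lemma allocate_at_turn : extends (give q (at_turn m q i) i) (allocate ord m q)
  /\ extends (at_turn m q i) (allocate ord m q) /\ at_turn m q i i = None.
Proof.
have i_s : i \in turn_order m by rewrite mem_filter i_ord inE mi eqxx.
have s_uniq : uniq (turn_order m) by rewrite filter_uniq.
have ms x : x \in turn_order m -> m x = None.
  by rewrite mem_filter inE; case/andP => /eqP.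
have sE : turn_order m = take (index i (turn_order m)) (turn_order m)
    ++ i :: drop (index i (turn_order m)).+1 (turn_order m).
  by rewrite -{1}(cat_take_drop (index i (turn_order m)) (turn_order m))
    (drop_nth i) ?index_mem // nth_index.
rewrite /allocate -/(turn_order m) {1 2}sE foldl_cat /= -/(at_turn m q i).
move: sE s_uniq ms; rewrite /at_turn.
move: (take _ _) (drop _ _) => s1 s2 ->; rewrite cat_uniq /= => /and3P[_].
rewrite negb_or => /andP[i1 /hasPn s21] /andP[i2 _] ms.
set m1 := foldl _ _ _.
have m1x x : x \in i :: s2 -> m1 x = None.
  move=> x2; rewrite /m1 foldl_give_notin; first by rewrite ms // mem_cat x2 orbT.
  by move: x2; rewrite inE => /predU1P[-> // | /s21].
have m1i := m1x i (mem_head _ _).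
split; last split => //; last by apply: (@foldl_give_extends q (i :: s2)).
apply: foldl_give_extends => x x2.
have xi : x != i by apply: contraNneq i2 => <-.
have := m1x x; rewrite inE x2 orbT => /(_ isT) m1x'.
rewrite /give; case: (q i) => // j; case: ifP => // _.
by rewrite ffunE (negPf xi).
Qed.

Lemma allocate_report_free j : q i = Some j -> j \in free_items (at_turn m q i) ->
  allocate ord m q i = Some j.
Proof.
move=> qi jf; case: allocate_at_turn => + _; apply.
by rewrite /give qi jf ffunE eqxx.
Qed.

(** Either [j] is free at the turn of [i], who then receives it, or it was gone before; an allocated
    item never becomes free again. *)
Lemma allocate_report_taken j : q i = Some j ->
  j \notin free_items (allocate ord m q).
Proof.
move=> qi; case: allocate_at_turn => _ [ext _].
have [jf|] := boolP (j \in free_items (at_turn m q i)).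
  by rewrite inE; apply/forallPn; exists i; rewrite (allocate_report_free qi jf) eqxx.
by apply: contra; apply/subsetP/extends_free_items.
Qed.

End Turn.

Lemma card_newly_taken m m' : extends m m' ->
  (#|free_items m :\: free_items m'| <= #|assigned m'| - #|assigned m|)%N.
Proof.
move=> mm'; rewrite -cardsDS ?extends_assigned //.
set A := _ :\: assigned m.
rewrite -(card_imset _ (@Some_inj _)).
(* Every newly taken item is the value of [m'] at a newly assigned player, so these items lie in the
   image of [A]. *)
apply: leq_trans (leq_imset_card m' A); apply/subset_leq_card/subsetP => _ /imsetP[j + ->].
rewrite !inE => /andP[/forallPn[i]]; rewrite negbK => /eqP m'i /forallP mj.
apply/imsetP; exists i => //; rewrite !inE m'i andbT negbK.
by case E: (m i) => [j'|//]; move: (mj i); rewrite E -(mm' _ _ E) m'i eqxx.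
Qed.

End Allocation.

(** * One random round: independence of reports and chances of a single player *)

Section Round.
Variables (R : realType) (n : nat) (dem : 'I_n -> {set 'I_n}) (ord : seq 'I_n).
Hypotheses (ord_uniq : uniq ord) (mem_ord : forall i, i \in ord).

Local Notation prob m := (reports_prob R dem m).

Lemma sum_option (F : option 'I_n -> R) :
  \sum_o F o = F None + \sum_j F (Some j).
Proof.
rewrite (bigD1 None) //=; congr (_ + _).
rewrite (reindex_omap Some id) => [|[]//].
by apply: eq_bigl => j; rewrite eqxx.
Qed.

Lemma report_prob_ge0 m i o : 0 <= report_prob R dem m i o.
Proof.
rewrite /report_prob; case: ifP => _; last exact: ler0n.
by case: o => [j|//]; rewrite divr_ge0.
Qed.

Lemma report_prob_sum m i : \sum_o report_prob R dem m i o = 1.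
Proof.
rewrite sum_option /report_prob; case: ifPn => [/andP[_ A0]|_].
  rewrite add0r -mulr_suml -natr_sum; set D := _ :&: _ in A0 *.
  have -> : (\sum_j (j \in D) = #|D|)%N by rewrite -sum1_card [RHS]big_mkcond.
  by rewrite mulfV // pnatr_eq0 cards_eq0.
by rewrite big1 ?addr0.
Qed.

Lemma report_probE (m : assignment n) i (D := free_items m :&: dem i) j :
  m i = None -> j \in D -> report_prob R dem m i (Some j) = #|D|%:R^-1.
Proof.
move=> mi jD; rewrite /report_prob inE mi eqxx -/D jD mul1r.
by have -> : D != set0 by apply/set0Pn; exists j.
Qed.

Lemma reports_prob_ge0 m q : 0 <= prob m q.
Proof. by apply: prodr_ge0 => i _; apply: report_prob_ge0. Qed.

Lemma reports_prob_sum m : \sum_q prob m q = 1.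
Proof.
rewrite /reports_prob -(bigA_distr_bigA (report_prob R dem m)).
by rewrite big1 // => i _; apply: report_prob_sum.
Qed.

(* Independence: resampling the report of [i] does not change the law. *)
Lemma mean_replace m i f : mean (prob m) f =
  mean (prob m) (fun q => \sum_o report_prob R dem m i o * f (replace q i o)).
Proof.
rewrite /mean; under [RHS]eq_bigr do rewrite mulr_sumr.
(* [h] swaps the stored report of [i] with the fresh one. Both have the same law, so the swap
   preserves the joint weight. *)
pose h (x : assignment n * option 'I_n) := (replace x.1 i x.2, x.1 i).
have hK : involutive h.
  case=> q o; rewrite /h /= !ffunE eqxx; congr (_, _).
  by apply/ffunP => x; rewrite !ffunE; case: eqP => // ->.
have replaceE q o x : x != i -> replace q i o x = q x.
  by move=> xi; rewrite ffunE (negPf xi).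
rewrite pair_big /= (reindex_inj (inv_inj hK)) /=.
transitivity (\sum_q \sum_o prob m q * report_prob R dem m i o * f q).
  apply: eq_bigr => q _.
  by rewrite -mulr_suml -mulr_sumr report_prob_sum mulr1.
rewrite pair_big /=; apply: eq_bigr => -[q o] _ /=.
have -> : replace (replace q i o) i (q i) = q by have [] := hK (q, o).
rewrite mulrA; congr (_ * _); rewrite /reports_prob.
rewrite (bigD1 i) //= [in RHS](bigD1 i) //= ffunE eqxx.
under [in RHS]eq_bigr => x xi do rewrite replaceE //.
by rewrite mulrAC [in RHS]mulrAC (mulrC (report_prob _ _ _ _ _)).
Qed.

Local Notation next := (allocate ord).

Definition residual (m : assignment n) i : R := #|free_items m :&: dem i|%:R.

Lemma mean_residual_le (m : assignment n) i : m i = None ->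
  mean (prob m) (fun q => residual (next m q) i) <=
  residual m i * mean (prob m) (fun q => (next m q i != None)%:R).
Proof.
(* Only the success indicator is resampled; the two sides are then compared for each fixed [q]. *)
move=> mi; rewrite (mean_replace _ i (fun q => (next m q i != None)%:R)) -meanZ.
apply: ler_mean => [|q]; first exact: reports_prob_ge0.
set D := free_items m :&: dem i; set D' := free_items (at_turn ord m q i) :&: D.
have [_ [ext' _]] := allocate_at_turn ord_uniq q (mem_ord i) mi.
have sub : free_items (next m q) :&: dem i \subset D'.
  rewrite subsetI (subset_trans (subsetIl _ _) (extends_free_items ext')).
  by rewrite setSI // extends_free_items //; apply: allocate_extends.
apply: (@le_trans _ _ #|D'|%:R); first by rewrite ler_nat subset_leq_card.
have [D0|D_gt0] := posnP #|D|.
  by rewrite {1}/D' (cards0_eq D0) setI0 cards0 mulr_ge0 ?sumr_ge0 // => o _;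
    rewrite mulr_ge0 ?report_prob_ge0.
rewrite -ler_pdivrMl ?ltr0n // sum_option.
(* Only reports in [D'], the demanded items free at the turn of [i], are kept: each has probability
   [1/#|D|] and makes [i] succeed. *)
apply: (@le_trans _ _ (\sum_(j in D') #|D|%:R^-1)).
  by rewrite sumr_const -[leRHS]mulr_natr.
apply: ler_wpDl; first by rewrite mulr_ge0 ?report_prob_ge0.
rewrite [leRHS](bigID (mem D')) /=; apply: ler_wpDr.
  by apply: sumr_ge0 => j _; rewrite mulr_ge0 ?report_prob_ge0.
apply: ler_sum => j; rewrite inE => /andP[jf jD].
rewrite report_probE // (@allocate_report_free _ _ ord_uniq _ _ _ _ _ j) //.
- by rewrite mulr1.
- by rewrite ffunE eqxx.
- by rewrite at_turn_replace.
Qed.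

Lemma mean_taken_ge (m : assignment n) i j : m i = None -> j \in free_items m :&: dem i ->
  1 <= residual m i *
    mean (prob m) (fun q => (j \notin free_items (next m q))%:R).
Proof.
move=> mi jD; rewrite (mean_replace _ i).
have D_gt0 : 0 < residual m i by rewrite ltr0n; apply/card_gt0P; exists j.
rewrite -ler_pdivrMl // mulr1.
rewrite -[leLHS](mean_cst (reports_prob_sum m)).
apply: ler_mean => [|q]; first exact: reports_prob_ge0.
rewrite (bigD1 (Some j)) //= report_probE //; apply: ler_wpDr.
  by apply: sumr_ge0 => o _; rewrite mulr_ge0 ?report_prob_ge0.
rewrite (@allocate_report_taken _ _ ord_uniq _ _ i) ?mulr1 //.
by rewrite ffunE eqxx.
Qed.

(** * Expected progress of one round, summed over the players *)

Definition matched (m : assignment n) : R := #|assigned m|%:R.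

Definition demanding t (m : assignment n) : R :=
  #|[set i | (m i == None) && (t < residual m i)]|%:R.

Lemma card_indicator (I : finType) (P : pred I) :
  #|[set i | P i]|%:R = \sum_i (P i)%:R :> R.
Proof.
rewrite -natr_sum; congr (_%:R).
by rewrite -sum1dep_card [LHS]big_mkcond.
Qed.

Lemma matchedE m : matched m = \sum_i (m i != None)%:R.
Proof. exact: card_indicator. Qed.

Lemma mean_matched m :
  mean (prob m) (fun q => matched (next m q)) =
  \sum_i mean (prob m) (fun q => (next m q i != None)%:R).
Proof. by rewrite -mean_sum; apply: eq_mean => q; rewrite matchedE. Qed.

Lemma matched_next m q : matched m <= matched (next m q).
Proof. by rewrite ler_nat subset_leq_card ?extends_assigned //; apply: allocate_extends. Qed.

Lemma mean_matched_ge m :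
  matched m <= mean (prob m) (fun q => matched (next m q)).
Proof.
rewrite -[leLHS](mean_cst (reports_prob_sum m)).
by apply: ler_mean => [|q]; [exact: reports_prob_ge0 | exact: matched_next].
Qed.

Lemma mean_le1 m (b : assignment n -> bool) :
  mean (prob m) (fun q => (b q)%:R) <= 1.
Proof.
rewrite -[leRHS](mean_cst (reports_prob_sum m)).
by apply: ler_mean => [|q]; [exact: reports_prob_ge0 | case: (b q)].
Qed.

(** Markov's inequality for each player. If [residual m i <= a * t], then [t] times the probability
    that [i] stays unassigned with residual above [t] is at most his mean new residual, hence at
    most [a * t] times his success probability. A larger residual is charged to
    [demanding (a * t) m]. *)
Lemma mean_demanding_next t a m : 0 < t -> 0 <= a ->
  mean (prob m) (fun q => demanding t (next m q)) <=
  demanding (a * t) m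
  + a * (mean (prob m) (fun q => matched (next m q)) - matched m).
Proof.
move=> t0 a0; rewrite mean_matched matchedE /demanding card_indicator.
rewrite (eq_mean _ (fun q => card_indicator _)) mean_sum.
rewrite -sumrB mulr_sumr -big_split; apply: ler_sum => i _ /=.
case mi: (m i) => [j|] /=.
  have ext q : next m q i = Some j by apply: allocate_extends.
  under eq_mean => q do rewrite ext /=.
  under [X in _ + a * (X - _)]eq_mean => q do rewrite ext /=.
  by rewrite !mean_cst ?reports_prob_sum // subrr mulr0 addr0.
have u0 : 0 <= mean (prob m) (fun q => (next m q i != None)%:R).
  by apply: mean_ge0 => [|q]; [exact: reports_prob_ge0 | exact: ler0n].
rewrite subr0; have [big|small] := ltP (a * t) (residual m i).
  by apply: le_trans (mean_le1 _ _) _; rewrite lerDl mulr_ge0.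
rewrite add0r.
rewrite -(ler_pM2l t0) mulrA [t * a]mulrC.
apply: (@le_trans _ _ (residual m i *
  mean (prob m) (fun q => (next m q i != None)%:R))); last exact: ler_wpM2r.
apply: le_trans (mean_residual_le mi); rewrite -meanZ.
apply: ler_mean => [|q]; first exact: reports_prob_ge0.
case: (_ == None) => /=; last by rewrite mulr0 ler0n.
by case: ltP => [/ltW|_]; rewrite ?mulr1 // mulr0 ler0n.
Qed.

Lemma no_assignment_extends (m : assignment n) : extends (no_assignment n) m.
Proof. by move=> i j; rewrite ffunE. Qed.

Lemma free_items0 : free_items (no_assignment n) = setT.
Proof. by apply/setP => j; rewrite !inE; apply/forallP => i; rewrite ffunE. Qed.

Lemma assigned0 : assigned (no_assignment n) = set0.
Proof. by apply/setP => i; rewrite !inE ffunE. Qed.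

Lemma card_taken_le (m : assignment n) : (#|~: free_items m| <= #|assigned m|)%N.
Proof.
have := card_newly_taken (@no_assignment_extends m).
by rewrite free_items0 setTD assigned0 cards0 subn0.
Qed.

Lemma residual_ge (m : assignment n) i : #|dem i|%:R - matched m <= residual m i.
Proof.
rewrite lerBlDr -natrD ler_nat -(cardsID (free_items m) (dem i)) setIC.
rewrite leq_add2l (leq_trans _ (card_taken_le m)) //.
by rewrite setDE subset_leq_card ?subsetIr.
Qed.

(** Let [E] be the mean size after the first round. A player with [s > t] demanded items has mean
    residual at least [s - E], so his success probability [u] satisfies [s - E <= s * u], whence
    [1 <= u + E / t]. Summing over [n] players gives the factor. *)
Lemma demanding0_le t : 0 < t -> demanding t (no_assignment n) <=
  (1 + n%:R / t)
  * mean (prob (no_assignment n)) (fun q => matched (next (no_assignment n) q)).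
Proof.
set m := no_assignment n; move=> t0; set E := mean _ _.
have E0 : 0 <= E.
  by apply: mean_ge0 => [|q]; [exact: reports_prob_ge0 | exact: ler0n].
have sum_nE : \sum_(i < n) E / t = n%:R / t * E.
  by rewrite sumr_const card_ord -[LHS]mulr_natl mulrA mulrAC.
rewrite mulrDl mul1r -sum_nE {1}/E mean_matched /demanding card_indicator.
rewrite -big_split; apply: ler_sum => i _ /=.
have u0 : 0 <= mean (prob m) (fun q => (next m q i != None)%:R).
  by apply: mean_ge0 => [|q]; [exact: reports_prob_ge0 | exact: ler0n].
have Et0 : 0 <= E / t by rewrite divr_ge0 // ltW.
have mi : m i = None by rewrite ffunE.
rewrite mi eqxx /=; case: ltP => [big|_] /=; last exact: addr_ge0.
have s0 : 0 < residual m i by apply: lt_trans big.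
apply: (@le_trans _ _ (mean (prob m) (fun q => (next m q i != None)%:R)
  + E / residual m i)); last first.
  by rewrite lerD2l ler_wpM2l // lef_pV2 ?posrE // ltW.
rewrite -(ler_pM2l s0) mulr1 mulrDr mulrCA mulfV ?gt_eqF // mulr1 -lerBlDr.
apply: le_trans (mean_residual_le mi).
rewrite -[X in X - E](mean_cst (reports_prob_sum m)) -meanB.
apply: ler_mean => [|q]; first exact: reports_prob_ge0.
by apply: le_trans (residual_ge _ _); rewrite /residual free_items0 setTI.
Qed.

Lemma sum_newly_taken_le (A : {set 'I_n}) (o : 'I_n -> 'I_n) m m' :
  extends m m' -> {in A &, injective o} ->
  \sum_(i in A) ((o i \in free_items m) && (o i \notin free_items m'))%:R
    <= matched m' - matched m :> R.
Proof.
move=> mm' o_inj; rewrite -natrB ?subset_leq_card ?extends_assigned //.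
rewrite -natr_sum ler_nat; apply: leq_trans (card_newly_taken mm').
rewrite -big_mkcondr sum1dep_card.
rewrite -(card_in_imset (f := o)); last first.
  by move=> x y; rewrite !inE => /andP[xA _] /andP[yA _]; apply: o_inj.
apply/subset_leq_card/subsetP => _ /imsetP[i + ->].
by rewrite !inE => /and3P[_ -> ->].
Qed.

(** Each player of [M] is already served, or has lost his item in [M], or has residual above [t], or
    sees that item taken in the coming round with probability at least [1/t]. The first two cases
    cost [matched m] each. *)
Lemma matching_size_le M t m : is_matching dem M -> 0 <= t ->
  #|assigned M|%:R <= 2 * matched m + demanding t m
    + t * (mean (prob m) (fun q => matched (next m q)) - matched m).
Proof.
case/andP => /forallP M_dem /forallP M_inj t0.
have [n0|n_gt0] := posnP n.
  have -> : #|assigned M| = 0%N.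
    by apply/eqP; rewrite -leqn0 -n0 -[leqRHS]card_ord max_card.
  by rewrite !addr_ge0 ?mulr_ge0 ?ler0n // subr_ge0 mean_matched_ge.
(* The default item is irrelevant: [o] is only used on players assigned by [M]. *)
pose o i := odflt (Ordinal n_gt0) (M i).
have oP i : i \in assigned M -> M i = Some (o i).
  by rewrite inE /o; case: (M i).
have o_dem i : i \in assigned M -> o i \in dem i.
  by move=> /oP Mi; have /forallP/(_ (o i)) := M_dem i; rewrite Mi eqxx.
have o_inj : {in assigned M &, injective o}.
  move=> i i' /oP Mi /oP Mi' oii'; apply/eqP.
  have /forallP/(_ i')/forallP/(_ (o i)) := M_inj i.
  by rewrite Mi Mi' oii' eqxx.
pose new i q : R :=
  ((o i \in free_items m) && (o i \notin free_items (next m q)))%:R.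
have new_ge0 i : 0 <= mean (prob m) (new i).
  by apply: mean_ge0 => [|q]; [exact: reports_prob_ge0 | exact: ler0n].
apply: (@le_trans _ _ (\sum_(i in assigned M) ((m i != None)%:R
  + (o i \notin free_items m)%:R
  + ((m i == None) && (t < residual m i))%:R + t * mean (prob m) (new i)))).
  rewrite -sum1_card natr_sum; apply: ler_sum => i iM.
  have tn0 : 0 <= t * mean (prob m) (new i) by rewrite mulr_ge0.
  case mi: (m i) => [j|] /=; first by rewrite -!addrA lerDl !addr_ge0.
  have [oi|_] /= := boolP (o i \in free_items m); last first.
    by rewrite add0r -addrA lerDl addr_ge0.
  rewrite !add0r; case: ltP => [_|st]; first by rewrite lerDl.
  rewrite add0r; have oD : o i \in free_items m :&: dem i by rewrite inE oi o_dem.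
  apply: le_trans (mean_taken_ge mi oD) _.
  rewrite (@eq_mean _ _ _ (new i) (fun q => (o i \notin free_items (next m q))%:R)).
    by apply: ler_wpM2r => //; apply: mean_ge0 => [|q];
      [exact: reports_prob_ge0 | exact: ler0n].
  by move=> q; rewrite /new oi.
rewrite !big_split /= -mulr_sumr; apply: lerD; first apply: lerD.
- rewrite mulr_natl mulr2n; apply: lerD.
    rewrite matchedE [leRHS](bigID (mem (assigned M))) /= lerDl.
    by apply: sumr_ge0 => i _; apply: ler0n.
  (* Distinct players of [M] have distinct items, so the lost items number at most the items taken
     in [m]. *)
  rewrite -natr_sum ler_nat; apply: leq_trans (card_taken_le m).
  rewrite -big_mkcondr sum1dep_card -(card_in_imset (f := o)); last first.
    by move=> x y; rewrite !inE => /andP[xA _] /andP[yA _]; apply: o_inj; rewrite inE.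
  apply/subset_leq_card/subsetP => _ /imsetP[i + ->].
  by rewrite !inE => /andP[_ ->].
- rewrite /demanding card_indicator [leRHS](bigID (mem (assigned M))) /= lerDl.
  by apply: sumr_ge0 => i _; apply: ler0n.
- apply: ler_wpM2l => //; rewrite -mean_sum.
  rewrite -[X in _ - X](mean_cst (reports_prob_sum m)) -meanB.
  apply: ler_mean => [|q]; first exact: reports_prob_ge0.
  by apply: sum_newly_taken_le => //; apply: allocate_extends.
Qed.

(** * Several rounds: chaining the one-round bounds *)

Local Notation law r := (greedy_law R dem ord r).

Lemma mean_law0 f : mean (law 0) f = f (no_assignment n).
Proof.
rewrite /mean (bigD1 (no_assignment n)) //= eqxx mul1r big1 ?addr0 // => m.
by move/negPf ->; rewrite mul0r.
Qed.

Lemma mean_lawS r f : mean (law r.+1) f =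
  mean (law r) (fun m => mean (prob m) (fun q => f (next m q))).
Proof.
rewrite /mean /=; under eq_bigr do rewrite mulr_suml.
rewrite exchange_big; apply: eq_bigr => m _ /=.
under eq_bigr do rewrite -mulrA; rewrite -mulr_sumr; congr (_ * _).
(* Report vectors are grouped by the allocation they lead to. *)
rewrite [RHS](partition_big (next m) xpredT) //=; apply: eq_bigr => m' _.
by rewrite mulr_suml; apply: eq_bigr => q /eqP ->.
Qed.

Lemma law_ge0 r m : 0 <= law r m.
Proof.
elim: r m => [|r IH] m /=; first exact: ler0n.
apply: sumr_ge0 => m' _; apply: mulr_ge0 => //.
by apply: sumr_ge0 => q _; apply: reports_prob_ge0.
Qed.

Lemma law_sum r : \sum_m law r m = 1.
Proof.
have -> : \sum_m law r m = mean (law r) (fun=> 1).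
  by apply: eq_bigr => m _; rewrite mulr1.
elim: r => [|r IH]; first by rewrite mean_law0.
rewrite mean_lawS -[RHS]IH; apply: eq_mean => m.
by rewrite mean_cst // reports_prob_sum.
Qed.

Local Notation expected_size := (greedy_expected_size R dem ord).

Lemma expected_sizeE r : expected_size r = mean (law r) matched.
Proof. by []. Qed.

Lemma expected_size0 : expected_size 0 = 0.
Proof. by rewrite expected_sizeE mean_law0 /matched assigned0 cards0. Qed.

Lemma expected_size_incr r : expected_size r <= expected_size r.+1.
Proof.
rewrite !expected_sizeE mean_lawS; apply: ler_mean => [|m].
  exact: law_ge0.
exact: mean_matched_ge.
Qed.

(** The threshold drops by a factor [a] per round, at a cost of [a] times the expected gain of that
    round; these gains telescope to [expected_size r]. *)
Lemma mean_demanding_law a k r : 0 < a -> (r <= k)%N ->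
  mean (law r) (demanding (a ^+ (k - r))) <=
  demanding (a ^+ k) (no_assignment n) + a * expected_size r.
Proof.
move=> a0; elim: r => [|r IH] rk.
  by rewrite mean_law0 expected_size0 mulr0 addr0 subn0.
rewrite mean_lawS.
apply: le_trans (ler_mean (@law_ge0 r) (fun m =>
  mean_demanding_next m (exprn_gt0 (k - r.+1) a0) (ltW a0))) _.
rewrite -exprS -subSn // subSS meanD meanZ meanB -mean_lawS -!expected_sizeE.
have := IH (ltnW rk); lra.
Qed.

Lemma matching_le_expected_size M k a : is_matching dem M -> 1 <= a ->
  n%:R <= a ^+ k.+2 ->
  #|assigned M|%:R <= 5 * a * expected_size k.+1.
Proof.
move=> M_matching a1 na; have a0 : 0 < a by apply: lt_le_trans a1.
have le1 r : expected_size 1 <= expected_size r.+1.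
  elim: r => // r IH; exact: le_trans (expected_size_incr _).
have first_round := demanding0_le (exprn_gt0 k.+1 a0).
have ratio : n%:R / a ^+ k.+1 <= a by rewrite ler_pdivrMr ?exprn_gt0 // -exprS.
(* Starting from [a ^+ k.+1], the first [k] of the [k.+1] rounds bring the threshold down to [a], as
   the last round requires. *)
have later_rounds := mean_demanding_law a0 (leqnSn k).
have last_round : #|assigned M|%:R <=
    2 * expected_size k + mean (law k) (demanding a)
    + a * (expected_size k.+1 - expected_size k).
  rewrite !expected_sizeE mean_lawS -meanB -!meanZ -!meanD.
  rewrite -[leLHS](mean_cst (law_sum k)).
  apply: ler_mean => [|m]; first exact: law_ge0.
  by apply: matching_size_le => //; apply: ltW.
rewrite subSn // subnn expr1 in later_rounds.
rewrite -[mean _ _](mean_law0 (fun m => mean (prob m) (fun q => matched (next m q))))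
  -mean_lawS -expected_sizeE in first_round.
have size1_ge0 : 0 <= expected_size 1 by rewrite -expected_size0 expected_size_incr.
have := le1 k; have := expected_size_incr k.
have : n%:R / a ^+ k.+1 * expected_size 1 <= a * expected_size 1 by apply: ler_wpM2r.
have : a * expected_size 1 <= a * expected_size k.+1 by apply: ler_wpM2l => //; apply: ltW.
have : 1 * expected_size k.+1 <= a * expected_size k.+1.
  by apply: ler_wpM2r => //; apply: le_trans (le1 k).
(* The terms [a * expected_size k] cancel, leaving [2 * expected_size k + (1 + a) * expected_size 1
   + a * expected_size k.+1]; monotonicity and [1 <= a] give the constant 5. *)
lra.
Qed.

End Round.

(** * Choice of [a] and the three approximation ratios *)

Lemma OPT_le_expected_size (R : realType) n k (dem : 'I_n -> {set 'I_n})
    (ord : seq 'I_n) :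
  (0 < n)%N -> (0 < k)%N -> perm_eq ord (enum 'I_n) ->
  (OPT dem)%:R <= 5 * n%:R `^ (1 / (k + 1)%:R)
    * greedy_expected_size R dem ord k.
Proof.
case: k => // k n_gt0 _ ord_perm; rewrite addn1.
have ord_uniq : uniq ord by rewrite (perm_uniq ord_perm) enum_uniq.
have mem_ord i : i \in ord by rewrite (perm_mem ord_perm) mem_enum.
set a := _ `^ _.
have a1 : 1 <= a by rewrite -(powRr0 (n%:R : R)) ler_powR ?ler1n // divr_ge0.
have aE : n%:R = a ^+ k.+2.
  by rewrite -powR_mulrn ?powR_ge0 // -powRrM divfK ?pnatr_eq0 // powRr1.
(* [OPT] is a maximum, so it suffices to bound 0 and the size of every matching. *)
apply: (big_ind (fun x => x%:R <= 5 * a * greedy_expected_size R dem ord k.+1)).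
- rewrite !mulr_ge0 ?powR_ge0 //.
  by apply: mean_ge0 => [m|m]; [exact: law_ge0 | exact: ler0n].
- by move=> x y; rewrite /maxn; case: ifP.
- by move=> M M_dem; apply: matching_le_expected_size; rewrite // -aE.
Qed.

Theorem theorem4p6 (R : realType) :
  (exists2 C : R, 0 < C &
    forall (n k : nat) (dem : 'I_n -> {set 'I_n}) (ord : seq 'I_n),
      (2 <= n)%N -> (1 <= k)%N -> k%:R <= log2 (n%:R : R) ->
      perm_eq ord (enum 'I_n) ->
      (OPT dem)%:R / (C * n%:R `^ (1 / (k + 1)%:R))
        <= greedy_expected_size R dem ord k) /\
  (exists2 C : R, 0 < C &
    forall (n : nat) (dem : 'I_n -> {set 'I_n}) (ord : seq 'I_n),
      (2 <= n)%N -> perm_eq ord (enum 'I_n) ->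
      (OPT dem)%:R / (C * Num.sqrt n%:R)
        <= greedy_expected_size R dem ord 1) /\
  (forall c1 c2 : R, 0 < c1 -> 0 < c2 ->
    exists2 C : R, 0 < C &
    forall (n k : nat) (dem : 'I_n -> {set 'I_n}) (ord : seq 'I_n),
      (2 <= n)%N ->
      c1 * log2 (n%:R : R) <= k%:R -> k%:R <= c2 * log2 (n%:R : R) ->
      perm_eq ord (enum 'I_n) ->
      (OPT dem)%:R / C <= greedy_expected_size R dem ord k).
Proof.
have size_ge k n (dem : 'I_n -> {set 'I_n}) ord (C : R) : (2 <= n)%N ->
    (1 <= k)%N -> perm_eq ord (enum 'I_n) -> 0 < C ->
    5 * n%:R `^ (1 / (k + 1)%:R) <= C ->
    (OPT dem)%:R / C <= greedy_expected_size R dem ord k.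
  move=> n2 k1 ord_perm C0 leC; rewrite ler_pdivrMr // mulrC.
  apply: le_trans (OPT_le_expected_size R dem (ltnW n2) k1 ord_perm) _.
  apply: ler_wpM2r leC.
  by apply: mean_ge0 => [m|m]; [exact: law_ge0 | exact: ler0n].
have n_gt0 n : (2 <= n)%N -> 0 < n%:R :> R by move=> n2; rewrite ltr0n ltnW.
split; [|split].
- exists 5 => // n k dem ord n2 k1 _ ord_perm.
  by apply: size_ge; rewrite // mulr_gt0 ?powR_gt0 ?n_gt0.
- exists 5 => // n dem ord n2 ord_perm.
  apply: size_ge; rewrite // ?mulr_gt0 ?sqrtr_gt0 ?n_gt0 //.
  by rewrite div1r powR12_sqrt.
(* The constant comes from [n <= 2 ^ ((k + 1) / c1)], which restates [c1 * log2 n <= k + 1]; taking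
   [(k + 1)]-th roots gives [2 ^ (1 / c1)]. *)
- move=> c1 c2 c1_gt0 _; exists (5 * 2 `^ (c1^-1)).
    by rewrite mulr_gt0 ?powR_gt0.
  move=> n k dem ord n2 k_ge _ ord_perm.
  have ln2_gt0 : 0 < ln 2 :> R by rewrite ln_gt0 // ltr1n.
  (* At least one round takes place, since [c1 * log2 n] is positive. *)
  have k1 : (1 <= k)%N.
    rewrite -(ltr0n R); apply: lt_le_trans k_ge.
    by rewrite mulr_gt0 // divr_gt0 // ln_gt0 // ltr1n.
  apply: size_ge; rewrite ?mulr_gt0 ?powR_gt0 //.
  rewrite ler_pM2l // -[c1^-1](mulfK (x := (k + 1)%:R)); last first.
    by rewrite addn1 pnatr_eq0.
  rewrite div1r powRrM.
  apply: ge0_ler_powR; rewrite ?nnegrE ?powR_ge0 ?invr_ge0 //.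
  rewrite -ler_ln ?posrE ?powR_gt0 ?n_gt0 // ln_powR -ler_pdivrMr //.
  rewrite ler_pdivlMl //; apply: le_trans k_ge _.
  by rewrite ler_nat leq_addr.
Qed.
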